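(* Let $\lambda>0$ and $q\ge0$, and take $h(\lambda,q)=\lambda^{1-q}$ in the definition of the Tsallis hypoentropies. Let $X$ and $Y$ be discrete random variables with $n$ and $m$ values respectively and joint probabilities $p(x_i,y_j)$. Then the chain rule holds: $$H_{\lambda,q}(X,Y)=H_{\lambda,q}(X)+H_{\lambda,q}(Y|X).$$
   Context: The $q$-logarithm is $\ln_q(x)=\frac{x^{1-q}-1}{1-q}$ for $x>0$, $q\neq 1$, with $\ln_1=\log$ (the limit $q\to1$). Marginals are $p(x_i)=\sum_j p(x_i,y_j)$. With $h(\lambda,q)=\lambda^{1-q}$ define, for $\lambda>0$, $$H_{\lambda,q}(X)=\lambda^{-q}\left\{-(1+\lambda)\ln_q\frac{1}{1+\lambda}+\sum_{i=1}^n(1+\lambda p(x_i))\ln_q\frac{1}{1+\lambda p(x_i)}\right\},$$ the joint Tsallis hypoentropy $$H_{\lambda,q}(X,Y)=\lambda^{-q}\left\{-(1+\lambda)\ln_q\frac{1}{1+\lambda}+\sum_{i=1}^n\sum_{j=1}^m(1+\lambda p(x_i,y_j))\ln_q\frac{1}{1+\lambda p(x_i,y_j)}\right\},$$ for $p(x_i)\ne0$ the Tsallis hypoentropy of $Y$ given $X=x_i$ at level $\lambda p(x_i)$ $$H_{\lambda p(x_i),q}(Y|x_i)=(\lambda p(x_i))^{-q}\left\{-(1+\lambda p(x_i))\ln_q\frac{1}{1+\lambda p(x_i)}+\sum_{j=1}^m(1+\lambda p(x_i,y_j))\ln_q\frac{1}{1+\lambda p(x_i,y_j)}\right\},$$ and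 the Tsallis conditional hypoentropy $$H_{\lambda,q}(Y|X)=\sum_{i=1}^n p(x_i)^q\,H_{\lambda p(x_i),q}(Y|x_i),$$ where summands with $p(x_i)=0$ are defined to be $0$. *)

(* Defs.v *)
From HB Require Import structures.
From mathcomp Require Import all_boot all_order all_algebra.
From mathcomp Require Import all_classical all_reals all_analysis.

Set Implicit Arguments.
Unset Strict Implicit.
Unset Printing Implicit Defensive.

Import Order.TTheory GRing.Theory Num.Theory.

Local Open Scope ring_scope.

(* The q-logarithm; it is only meant to be used at x > 0. *)
Definition lnq (R : realType) (q x : R) : R :=
  if q == 1 then ln x else (x `^ (1 - q) - 1) / (1 - q).

(* p i j is the joint probability p(x_i, y_j). *)
Definition joint_distribution (R : realType) (n m : nat)
    (p : 'I_n -> 'I_m -> R) : Prop :=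
  (forall i j, 0 <= p i j) /\ \sum_(i < n) \sum_(j < m) p i j = 1.

Definition marginal1 (R : realType) (n m : nat) (p : 'I_n -> 'I_m -> R)
    (i : 'I_n) : R :=
  \sum_(j < m) p i j.

(* The Tsallis hypoentropies below are those with h(lambda, q) =
   lambda ^ (1 - q), so that the prefactor h(lambda, q) / lambda is
   lambda ^ (- q). *)

Definition hypoentropy (R : realType) (n : nat) (lambda q : R)
    (p : 'I_n -> R) : R :=
  lambda `^ (- q) *
  (- (1 + lambda) * lnq q (1 / (1 + lambda)) +
   \sum_(i < n) (1 + lambda * p i) * lnq q (1 / (1 + lambda * p i))).

Definition joint_hypoentropy (R : realType) (n m : nat) (lambda q : R)
    (p : 'I_n -> 'I_m -> R) : R :=
  lambda `^ (- q) *
  (- (1 + lambda) * lnq q (1 / (1 + lambda)) +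
   \sum_(i < n) \sum_(j < m)
     (1 + lambda * p i j) * lnq q (1 / (1 + lambda * p i j))).

(* H_{lambda p(x_i), q}(Y | x_i), meaningful when p(x_i) != 0.  Its level is
   lambda p(x_i), and lambda p(x_i) p(y_j | x_i) is lambda p(x_i, y_j). *)
Definition hypoentropy_given (R : realType) (n m : nat) (lambda q : R)
    (p : 'I_n -> 'I_m -> R) (i : 'I_n) : R :=
  (lambda * marginal1 p i) `^ (- q) *
  (- (1 + lambda * marginal1 p i) * lnq q (1 / (1 + lambda * marginal1 p i)) +
   \sum_(j < m) (1 + lambda * p i j) * lnq q (1 / (1 + lambda * p i j))).

(* Summands with p(x_i) = 0 are 0 by convention. *)
Definition conditional_hypoentropy (R : realType) (n m : nat) (lambda q : R)
    (p : 'I_n -> 'I_m -> R) : R :=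
  \sum_(i < n)
    if marginal1 p i == 0 then 0
    else marginal1 p i `^ q * hypoentropy_given lambda q p i.

(* Main.v *)
Require Import Defs.
From HB Require Import structures.
From mathcomp Require Import all_boot all_order all_algebra.
From mathcomp Require Import all_classical all_reals all_analysis.

Set Implicit Arguments.
Unset Strict Implicit.
Unset Printing Implicit Defensive.

Import Order.TTheory GRing.Theory Num.Theory.

Local Open Scope ring_scope.

(* Telescoping: since s^q (lambda s)^(-q) = lambda^(-q), the weighted entropy of
   Y given x_i is lambda^(-q) (sum_j T (p i j) - T (p(x_i))), where
   T x = (1 + lambda x) ln_q (1 / (1 + lambda x)); the T (p(x_i)) cancel those of
   H(X).  When p(x_i) = 0 all terms of row i vanish because T 0 = 0. *)

Lemma lnq1 (R : realType) (q : R) : lnq q 1 = 0.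
Proof. by rewrite /lnq; case: eqP => _; rewrite ?ln1 // powR1 subrr mul0r. Qed.

(** The weight turns the row-dependent prefactor into one independent of [i], so the rows can be
    summed under a common factor. *)
Lemma powR_hypoentropy_given (R : realType) (n m : nat) (lambda q : R)
    (p : 'I_n -> 'I_m -> R) (i : 'I_n) :
  0 <= lambda -> 0 < marginal1 p i ->
  marginal1 p i `^ q * hypoentropy_given lambda q p i =
  lambda `^ (- q) *
  (\sum_(j < m) (1 + lambda * p i j) * lnq q (1 / (1 + lambda * p i j)) -
   (1 + lambda * marginal1 p i) * lnq q (1 / (1 + lambda * marginal1 p i))).
Proof.
move=> lambda_ge0 s_gt0; rewrite /hypoentropy_given powRM ?(ltW s_gt0) //.
(* The exponents [q] and [- q] add up to [0], so merging the two powers needs a nonzero base. *)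
rewrite [X in _ * (X * _)]mulrC !mulrA -powRD; last first.
  by rewrite (gt_eqF s_gt0) implybT.
by rewrite subrr powRr0 mul1r mulNr addrC.
Qed.

Theorem lemma4p2 (R : realType) (n m : nat) (lambda q : R)
  (p : 'I_n -> 'I_m -> R) (lambda_gt0 : 0 < lambda) (q_ge0 : 0 <= q)
  (p_joint : joint_distribution p) :
  joint_hypoentropy lambda q p =
  hypoentropy lambda q (marginal1 p) + conditional_hypoentropy lambda q p.
Proof.
case: p_joint => p_ge0 _.
rewrite /joint_hypoentropy /hypoentropy /conditional_hypoentropy.
set T := fun x => (1 + lambda * x) * lnq q (1 / (1 + lambda * x)).
have T0 : T 0 = 0 by rewrite /T mulr0 addr0 divr1 lnq1 mulr0.
rewrite [X in _ = _ + X](_ : _ = lambda `^ (- q) *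
    (\sum_(i < n) (\sum_(j < m) T (p i j) - T (marginal1 p i)))).
  by rewrite -mulrDr sumrB -addrA subrKC.
rewrite mulr_sumr; apply: eq_bigr => i _; case: eqP => [s0|/eqP s_neq0].
  (* A vanishing sum of nonnegative terms forces every [p i j] of the row to be [0], which agrees
     with the convention for null summands. *)
  rewrite s0 T0 subr0 big1 ?mulr0 // => j _.
  by rewrite (psumr_eq0P _ s0) // => k _; exact: p_ge0.
rewrite powR_hypoentropy_given ?(ltW lambda_gt0) // lt_neqAle eq_sym s_neq0.
by apply: sumr_ge0 => j _; exact: p_ge0.
Qed.
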